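(* Consider a generic VCG auction $(L,w)$ cleared by the single-stage procurement model described in the context. Suppose that for all $j\in L$ the bids $B_j$ satisfy the increasing marginal cost condition: $p_j^{(b)}-p_j^{(a)}=p_j^{(d)}-p_j^{(c)}>0$ with $0\le p_j^{(a)}<p_j^{(c)}$ implies $$c_j^{(d)}-c_j^{(c)}>c_j^{(b)}-c_j^{(a)}.$$ Then: (i) Any group of losing bidders cannot profit by jointly lowering the bids. (ii) Bidding with multiple identities is always unprofitable.
   Context: A system operator (TSO, player $0$) procures a fixed amount of $M$ MW of power from a set $L$ of participants. Each participant $j$ submits bids $B_j=(c_j,p_j)$, where $p_j\in\mathbb{R}^{n_j}$ is the vector of offered power amounts and $c_j\in\mathbb{R}^{n_j}$ the vector of corresponding requested costs. The offered amounts are equally spaced by an increment $m$, which is a divisor of $M$ and is chosen by the TSO: each $j$ bids on power offers $p_j^{(k)}=km$, $k\in\mathbb{Z}$, and $c_j^{(k)}$ denotes the cost requested for $p_j^{(k)}$, with cost $c_j^{(0)}=0$ for zero power. $\bar c_j$ is the true cost vector of $j$ for the offers $p_j$. For a set $S$ of participants the auction is cleared by $$J^\star(S)=\min_{x}\ \sum_{j\in S}c_j^\top x_j\quad\text{s.t.}\quad \sum_{j\in S}p_j^\top x_j\ge M,\qquad \mathbf 1^\top x_j\le 1\ \ \forall j\in S,$$ with $x_j\in\{0,1\}^{n_j}$ indicating which bids of $j$ are accepted (so at most one offer of each participant is accepted); $x^\star$ denotes the optimal $x$. The associated coalitional value function is $w(S)=-J^\star(S)$ if the TSO belongs to $S$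 and $w(S)=0$ otherwise, where costs are taken to be the true ones. Under the VCG mechanism (with the Clarke pivot rule) the accepted bids are given by $x^\star(B)$, for $B=\{B_j,\ j\in L\}$ the set of all bids, and $j$ receives the payment $q_j(B)=J^\star(B^{-j})-J^\star(B)+c_j^\top x_j^\star(B)$, where $J^\star(B)$ and $J^\star(B^{-j})$ are the optimal costs given all bids and given all bids excluding $j$'s. The profit (utility) of $j$ is $u_j(B)=q_j(B)-\bar c_j^\top x_j^\star(B)$. In (i), losing bidders are participants who have no bid accepted when they bid their true costs $(\bar c_j,p_j)$; jointly lowering the bids means that they instead all bid lowered costs $(\tilde c_j,p_j)$ so as to become winners. In (ii), bidding with multiple identities (shill bidding) means that a single participant enters the auction as several of the bidders in $L$ rather than as one bidder. *)

(* Defs.v *)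
From mathcomp Require Import all_boot all_order all_algebra.
From mathcomp Require Import reals constructive_ereal.

Set Implicit Arguments.
Unset Strict Implicit.
Unset Printing Implicit Defensive.

Import Order.TTheory GRing.Theory Num.Theory.
Local Open Scope ring_scope.

Section Offers.
Variables (R : realType) (n : nat).
Implicit Types (p c v : 'cV[R]_n) (y : {ffun 'I_n -> bool}).

(* v^T y for a 0/1 vector y *)
Definition accepted v y : R := \sum_(k < n) v k ord0 * (y k)%:R.

(* The coordinates of a bid are its nonzero offers; the offer number 0, of zero
   power at zero cost, is implicit.  [with_zero v k] is the k-th entry v^(k),
   where v^(0) = 0 and v^(k) is the coordinate of index k - 1 for k > 0. *)
Definition with_zero v (k : 'I_n.+1) : R :=
  if unlift ord0 k is Some i then v i ord0 else 0.

Definition equally_spaced (m : R) p : Prop :=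
  forall k : 'I_n.+1, with_zero p k = k%:R * m.

Definition increasing_marginal_cost p c : Prop :=
  forall a b e d : 'I_n.+1,
    with_zero p b - with_zero p a = with_zero p d - with_zero p e ->
    0 < with_zero p d - with_zero p e ->
    0 <= with_zero p a -> with_zero p a < with_zero p e ->
    with_zero c b - with_zero c a < with_zero c d - with_zero c e.

End Offers.

(* T indexes the potential bidders, n j is the number of (nonzero) offers of j;
   the auction is held among the members of a set S of bidders. *)
Section Auction.
Variables (R : realType) (T : finType) (n : T -> nat) (M : R).

Definition profile := forall j : T, 'cV[R]_(n j).
Definition allocation := {dffun forall j : T, {ffun 'I_(n j) -> bool}}.

Implicit Types (p c cbar : profile) (S : {set T}) (x : allocation).

Definition feasible p S x : bool :=
  (M <= \sum_(j in S) accepted (p j) (x j)) &&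
  [forall j in S, (\sum_(k < n j) x j k <= 1)%N].

Definition total_cost c S x : R := \sum_(j in S) accepted (c j) (x j).

(* J^*(S); it is +oo if the members of S cannot supply M. *)
Definition optimal_cost p c S : \bar R :=
  \big[mine/+oo%E]_(x : allocation | feasible p S x) (total_cost c S x)%:E.

(* x is one of the minimizers: no tie-breaking rule is imposed on x^*. *)
Definition optimal p c S x : Prop :=
  feasible p S x /\
  forall y, feasible p S y -> total_cost c S x <= total_cost c S y.

(* Payment q_j when the bids are (c, p) and the allocation x is selected. *)
Definition vcg_payment p c S x (j : T) : \bar R :=
  (optimal_cost p c (S :\ j) - optimal_cost p c S
   + (accepted (c j) (x j))%:E)%E.

Definition utility p c cbar S x (j : T) : \bar R :=
  (vcg_payment p c S x j - (accepted (cbar j) (x j))%:E)%E.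

Definition losing x (j : T) : Prop := forall k : 'I_(n j), x j k = false.

End Auction.

(* Bidders [option T]: [Some j] is the bidder j of T and [None] is a single
   bidder standing for the participant behind several identities in T. *)
Section SingleIdentity.
Variables (R : realType) (T : finType) (n : T -> nat) (n0 : nat).

Definition single_size (o : option T) : nat :=
  if o is Some j then n j else n0.

Definition single_profile (v : profile R n) (v0 : 'cV[R]_n0) :
    profile R single_size :=
  fun o => match o return 'cV[R]_(single_size o) with
           | Some j => v j
           | None => v0
           end.

Definition single_bidders (C : {set T}) : {set option T} :=
  None |: [set Some j | j in ~: C].

End SingleIdentity.

(* Main.v *)
(** With increasing marginal costs each bidder's cost is a convex function of
    the number of increments m it supplies, so the cheapest cost at which a
    fixed set S of bidders supplies at least b increments is convex in b.
    (i) In the truthful optimum the bidders outside K supply all of M, and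
    replacing r of these increments by the power of a loser j in K does not
    pay.  If the other members of K supply a part of M, convexity makes the
    last r increments of the remaining bidders even cheaper, so j's winning
    offer is worth at most its true cost.
    (ii) By convexity the marginal contributions of the identities in C add up
    to at most the marginal contribution of C as a whole, which is what the
    single bidder earns. *)

Require Import Defs.
From mathcomp Require Import all_boot all_order all_algebra.
From mathcomp Require Import reals constructive_ereal.
From mathcomp Require Import zify lra.

Set Implicit Arguments.
Unset Strict Implicit.
Unset Printing Implicit Defensive.

Import Order.TTheory GRing.Theory Num.Theory.
Local Open Scope ring_scope.

(** * Offers counted in increments, and convexity of costs *)

Section Offers.
Variables (R : realType) (n : nat).
Implicit Types (v c : 'cV[R]_n) (y : {ffun 'I_n -> bool}).

(** Indexing by [nat] lets increments be added and subtracted freely; [inord] sends an index beyond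
    [n] to 0, so such an offer has value 0. *)
Definition offer v (i : nat) : R := with_zero v (inord i).

Definition single_offer (i : nat) : {ffun 'I_n -> bool} :=
  [ffun k : 'I_n => k.+1 == i].

Lemma offer0 v : offer v 0 = 0.
Proof.
rewrite /offer /with_zero.
have -> : inord 0 = ord0 :> 'I_n.+1 by apply: val_inj; rewrite /= inordK.
by rewrite unlift_none.
Qed.

Lemma offerS v (k : 'I_n) : offer v k.+1 = v k ord0.
Proof.
rewrite /offer /with_zero.
have -> : inord k.+1 = lift ord0 k :> 'I_n.+1.
  by apply: val_inj; rewrite /= inordK // ltnS ltn_ord.
by rewrite liftK.
Qed.

Lemma single_offer_sum i : (\sum_(k < n) single_offer i k <= 1)%N.
Proof.
case: i => [|i]; first by rewrite big1 // => k _; rewrite ffunE.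
have [lt_in|le_ni] := ltnP i n; last first.
  rewrite big1 // => k _; rewrite ffunE eqSS ltn_eqF //.
  exact: leq_trans (ltn_ord k) le_ni.
rewrite (bigD1 (Ordinal lt_in)) //= big1 ?addn0 ?leq_b1 // => k ne_k.
by rewrite ffunE eqSS; move: ne_k; rewrite -val_eqE /= => /negbTE ->.
Qed.

Lemma single_offerP y : (\sum_(k < n) y k <= 1)%N ->
  exists2 i, (i <= n)%N & y = single_offer i.
Proof.
move=> y_le1; have [/existsP[k yk]|] := boolP [exists k, y k]; last first.
  rewrite negb_exists => /forallP yF; exists 0%N => //.
  by apply/ffunP => k; rewrite ffunE (negbTE (yF k)).
exists k.+1 => //; apply/ffunP => l; rewrite ffunE eqSS.
have [/val_inj -> //|ne_lk] := eqVneq (val l) (val k).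
apply: contraTF y_le1 => yl.
by rewrite -ltnNge (bigD1 k) //= (bigD1 l) ?yk ?yl //= -val_eqE.
Qed.

Lemma accepted_single_offer v i : (i <= n)%N ->
  accepted v (single_offer i) = offer v i.
Proof.
case: i => [_|i lt_in].
  by rewrite offer0 /accepted big1 // => k _; rewrite ffunE mulr0.
rewrite /accepted (bigD1 (Ordinal lt_in)) //= big1 ?addr0.
  by rewrite ffunE eqxx mulr1 -offerS.
move=> k ne_k; rewrite ffunE eqSS.
by move: ne_k; rewrite -val_eqE /= => /negbTE ->; rewrite mulr0.
Qed.

Lemma offer_spaced (m : R) p i : @equally_spaced R n m p -> (i <= n)%N ->
  offer p i = i%:R * m.
Proof. by move=> spaced le_in; rewrite /offer spaced inordK. Qed.

Definition convex_on_offers (g : nat -> R) : Prop :=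
  forall a b d, (a <= b <= d)%N -> (d <= n)%N ->
  g b + g (a + d - b)%N <= g a + g d.

(** The steps from [a] to [b] and from [e = a + d - b] to [d] add the same power, and the second
    starts higher because [b < d]; the marginal cost condition compares exactly these two. If
    [a = b] or [b = d] there is equality. *)
Lemma increasing_marginal_cost_convex (m : R) p c : 0 < m ->
  @equally_spaced R n m p -> increasing_marginal_cost p c ->
  convex_on_offers (offer c).
Proof.
move=> m_gt0 spaced imc a b d /andP[le_ab le_bd] le_dn.
have [->|ne_ab] := eqVneq a b; first by rewrite addKn.
have [->|ne_bd] := eqVneq b d; first by rewrite addnK addrC.
set e := (a + d - b)%N.
have powE i : (i <= n)%N -> with_zero p (inord i) = i%:R * m.
  exact: offer_spaced.
have := imc (inord a) (inord b) (inord e) (inord d).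
rewrite !powE ?/e; try lia.
rewrite -!mulrBl -!natrB; try lia.
have -> : (d - (a + d - b) = b - a)%N by lia.
have lt_ae : a%:R * m < (a + d - b)%:R * m by rewrite ltr_pM2r ?ltr_nat //; lia.
have step_gt0 : 0 < (b - a)%:R * m by rewrite mulr_gt0 ?ltr0n //; lia.
have a_ge0 : 0 <= a%:R * m by rewrite mulr_ge0 ?ler0n // ltW.
move=> /(_ erefl step_gt0 a_ge0 lt_ae); rewrite /offer; lra.
Qed.

End Offers.

(** * Exchanging increments between two supply plans *)

Lemma intermediate_sum (I : finType) (S : {set I}) (u w : I -> nat) (d : nat) :
  (forall j, u j <= w j)%N ->
  (\sum_(j in S) u j + d <= \sum_(j in S) w j)%N ->
  exists2 z : I -> nat, (forall j, u j <= z j <= w j)%N &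
    (\sum_(j in S) z j = \sum_(j in S) u j + d)%N.
Proof.
elim: d u => [|d IHd] u le_uw le_sum.
  by exists u => [j|]; rewrite ?leqnn ?le_uw ?addn0.
have /exists_inP[j jS lt_j] : [exists j in S, (u j < w j)%N].
  apply: contraTT le_sum; rewrite negb_exists_in => /forall_inP ge_uw.
  rewrite -ltnNge addnS ltnS; apply: leq_trans (leq_addr _ _).
  by apply: leq_sum => j /ge_uw; rewrite -leqNgt.
have sum_u1 : (\sum_(i in S) (u i + (i == j)) = (\sum_(i in S) u i).+1)%N.
  rewrite big_split /= (bigD1 j jS) /= [X in (_ + X)%N](bigD1 j jS) /=.
  rewrite eqxx [X in (_ + (_ + X))%N]big1 ?addn0 ?addn1 // => i.
  by case/andP=> _ /negbTE->.
case: (IHd (fun i => u i + (i == j))%N) => [i||z le_z sum_z].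
- by case: eqVneq => [->|_]; rewrite ?addn1 ?addn0.
- by rewrite sum_u1 addSnnS.
- exists z => [i|]; last by rewrite sum_z sum_u1 addSnnS.
  case/andP: (le_z i) => le1 ->; rewrite andbT.
  exact: leq_trans (leq_addr _ _) le1.
Qed.

(** If [u] falls short of [a], raise it towards the pointwise maximum of [u] and [v] until its total
    is [a], and take the same increments away from [v]. The combined supply is unchanged, and each
    bidder's two amounts move closer together, which convexity makes no dearer. *)
Lemma exchange (R : realType) (I : finType) (n : I -> nat) (g : I -> nat -> R)
    (S : {set I}) (u v : I -> nat) (a b : nat) :
  (forall j, j \in S -> convex_on_offers (n j) (g j)) ->
  (forall j, u j <= n j)%N -> (forall j, v j <= n j)%N ->
  (a + b <= \sum_(j in S) u j + \sum_(j in S) v j)%N ->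
  (a <= \sum_(j in S) v j)%N -> (b <= \sum_(j in S) v j)%N ->
  exists u' v' : I -> nat,
    [/\ forall j, (u' j <= n j)%N, forall j, (v' j <= n j)%N,
        (a <= \sum_(j in S) u' j)%N, (b <= \sum_(j in S) v' j)%N &
        \sum_(j in S) g j (u' j) + \sum_(j in S) g j (v' j) <=
        \sum_(j in S) g j (u j) + \sum_(j in S) g j (v j)].
Proof.
move=> g_conv le_un le_vn le_ab le_a le_b.
have [le_au|lt_ua] := leqP a (\sum_(j in S) u j).
  by exists u, v; split.
pose w j := maxn (u j) (v j).
have [j||u' le_u' sum_u'] :=
  @intermediate_sum _ S u w (a - \sum_(j in S) u j).
- exact: leq_maxl.
- rewrite subnKC ?(ltnW lt_ua) //; apply: leq_trans le_a _.
  by apply: leq_sum => j _; apply: leq_maxr.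
pose v' j := (u j + v j - u' j)%N.
rewrite subnKC ?(ltnW lt_ua) // in sum_u'.
have le_w j : (w j <= u j + v j)%N by rewrite /w; lia.
have sum_v' : (\sum_(j in S) u' j + \sum_(j in S) v' j =
    \sum_(j in S) u j + \sum_(j in S) v j)%N.
  rewrite -!big_split /=; apply: eq_bigr => j _; rewrite subnKC //.
  by case/andP: (le_u' j) => _ /leq_trans ->.
exists u', v'; split.
- move=> j; have := le_u' j; have := le_un j; have := le_vn j.
  rewrite /w; lia.
- move=> j; have := le_u' j; have := le_un j; have := le_vn j.
  rewrite /v' /w; lia.
- by rewrite sum_u'.
- by move: sum_v' le_ab; rewrite sum_u'; lia.
- rewrite -!big_split /=; apply: ler_sum => j jS.
  have := le_u' j; rewrite /v' /w; have [le_uv|lt_vu] := leqP (u j) (v j).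
    by move=> le_j; apply: g_conv => //; lia.
  (* Where [v j < u j] the maximum is [u j], so nothing moved. *)
  rewrite -eqn_leq => /eqP <-; by rewrite addKn.
Qed.

Lemma setTD1I (I : finType) (A : {set I}) (j : I) :
  ([set: I] :\ j) :&: A = A :\ j.
Proof. by apply/setP => i; rewrite !inE andbT. Qed.

Lemma setTD1D (I : finType) (A : {set I}) (j : I) : j \in A ->
  ([set: I] :\ j) :\: A = ~: A.
Proof.
move=> jA; apply/setP => i; rewrite !inE andbT.
by case: eqVneq => [->|_]; rewrite ?jA ?andbT.
Qed.

(** Removing the head [i] shifts the base from [x] to [x + r i] and keeps [A]; convexity bounds the
    head's term by [f x - f (x + r i)], and the bounds telescope. *)
Lemma superadditive_sum (R : realType) (f : nat -> R) :
  (forall x a b, f (x + a)%N + f (x + b)%N <= f (x + a + b)%N + f x) ->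
  forall (I : Type) (s : seq I) (r : I -> nat) (x : nat),
  let A := (x + \sum_(i <- s) r i)%N in
  \sum_(i <- s) (f (A - r i)%N - f A) <= f x - f A.
Proof.
move=> f_conv I s r; elim: s => [|i s IHs] x /=.
  by rewrite !big_nil addn0 subrr.
rewrite !big_cons addnA; have := IHs (x + r i)%N; rewrite /=.
set A := (_ + \sum_(_ <- _) _)%N; have := f_conv x (\sum_(i <- s) r i)%N (r i).
have -> : (x + \sum_(i <- s) r i = A - r i)%N by rewrite /A; lia.
have -> : (A - r i + r i = A)%N by rewrite /A; lia.
lra.
Qed.

(** * The clearing problem in units of the increment *)

Section Clearing.
Variables (R : realType) (T : finType) (n : T -> nat) (m : R) (p : profile R n).
Hypothesis m_gt0 : 0 < m.
Hypothesis p_spaced : forall j, equally_spaced m (p j).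
Implicit Types (c : profile R n) (S : {set T}) (x : allocation n)
  (f : T -> nat).

Definition alloc f : allocation n := [ffun j => single_offer (n j) (f j)].

Lemma total_power S x f : (forall j, f j <= n j)%N ->
  (forall j, j \in S -> x j = single_offer (n j) (f j)) ->
  \sum_(j in S) accepted (p j) (x j) = (\sum_(j in S) f j)%:R * m.
Proof.
move=> le_fn xE; rewrite natr_sum mulr_suml; apply: eq_bigr => j jS.
by rewrite xE // accepted_single_offer // (offer_spaced (@p_spaced j)).
Qed.

Lemma feasible_alloc (q : nat) S f : (forall j, f j <= n j)%N ->
  (q <= \sum_(j in S) f j)%N -> feasible (q%:R * m) p S (alloc f).
Proof.
move=> le_fn le_q; apply/andP; split; last first.
  by apply/forall_inP => j _; rewrite ffunE single_offer_sum.
rewrite (total_power le_fn) ?ler_pM2r ?ler_nat // => j _.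
by rewrite ffunE.
Qed.

Lemma feasibleP (q : nat) S x : feasible (q%:R * m) p S x ->
  exists f, [/\ forall j, (f j <= n j)%N, (q <= \sum_(j in S) f j)%N &
    forall j, j \in S -> x j = single_offer (n j) (f j)].
Proof.
case/andP => le_q /forall_inP one_x.
have {}one_x j : exists i, (i <= n j)%N &&
    ((j \in S) ==> (x j == single_offer (n j) i)).
  (* Feasibility says nothing about [x j] outside [S]; any count in range will do there. *)
  have [jS|jS] := boolP (j \in S); last by exists 0%N.
  by have [i le_in ->] := single_offerP (one_x j jS);
    exists i; rewrite le_in /=.
have one j := xchooseP (one_x j).
pose f j := xchoose (one_x j).
have xE j : j \in S -> x j = single_offer (n j) (f j).
  by move=> jS; have /andP[_ /implyP/(_ jS)/eqP] := one j.
have le_fn j : (f j <= n j)%N by have /andP[] := one j.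
exists f; split=> //; move: le_q.
by rewrite (total_power le_fn xE) ler_pM2r // ler_nat.
Qed.

Lemma optimal_cost_le (q : nat) c S f : (forall j, f j <= n j)%N ->
  (q <= \sum_(j in S) f j)%N ->
  (optimal_cost (q%:R * m) p c S <= (\sum_(j in S) offer (c j) (f j))%:E)%E.
Proof.
move=> le_fn le_q.
have -> : \sum_(j in S) offer (c j) (f j) = total_cost c S (alloc f).
  by apply: eq_bigr => j _; rewrite ffunE accepted_single_offer.
exact: bigmin_le_cond (feasible_alloc le_fn le_q).
Qed.

Lemma optimal_costE M c S x : optimal M p c S x ->
  optimal_cost M p c S = (total_cost c S x)%:E.
Proof.
case=> x_feas x_min; apply/eqP; rewrite eq_le; apply/andP; split.
  exact: bigmin_le_cond.
by apply: le_bigmin => [|y /x_min]; rewrite ?leey ?lee_fin.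
Qed.

Lemma optimal_cost_attained M c S :
  optimal_cost M p c S = +oo%E \/ exists x, optimal M p c S x.
Proof.
have [/existsP[x0 x0_feas]|] := boolP [exists x, feasible M p S x]; last first.
  rewrite negb_exists => /forallP infeas; left.
  by rewrite /optimal_cost big_pred0 // => x; apply: negbTE.
right; case: (arg_minP (total_cost c S) x0_feas) => x x_feas x_min.
by exists x.
Qed.

Lemma optimalP (q : nat) c S x : optimal (q%:R * m) p c S x ->
  exists f, [/\ forall j, (f j <= n j)%N, (q <= \sum_(j in S) f j)%N,
    forall j, j \in S -> x j = single_offer (n j) (f j) &
    optimal_cost (q%:R * m) p c S = (\sum_(j in S) offer (c j) (f j))%:E].
Proof.
move=> x_opt; have [f [le_fn le_q xE]] := feasibleP x_opt.1.
exists f; split=> //; rewrite (optimal_costE x_opt); congr (_%:E).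
by apply: eq_bigr => j jS; rewrite xE // accepted_single_offer.
Qed.

Lemma optimal_costP (q : nat) c S :
  optimal_cost (q%:R * m) p c S = +oo%E \/
  exists f, [/\ forall j, (f j <= n j)%N, (q <= \sum_(j in S) f j)%N &
    optimal_cost (q%:R * m) p c S = (\sum_(j in S) offer (c j) (f j))%:E].
Proof.
have [->|[x /optimalP[f [? ? _ ?]]]] := optimal_cost_attained (q%:R * m) c S.
  by left.
by right; exists f.
Qed.

Lemma optimal_cost_glue (q : nat) c S (A : {set T}) f g :
  (forall j, f j <= n j)%N -> (forall j, g j <= n j)%N ->
  (q <= \sum_(j in S :&: A) f j + \sum_(j in S :\: A) g j)%N ->
  (optimal_cost (q%:R * m) p c S <=
   (\sum_(j in S :&: A) offer (c j) (f j) +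
    \sum_(j in S :\: A) offer (c j) (g j))%:E)%E.
Proof.
move=> le_fn le_gn le_q; pose h j := if j \in A then f j else g j.
have hI j : j \in S :&: A -> h j = f j by rewrite inE /h => /andP[_ ->].
have hD j : j \in S :\: A -> h j = g j.
  by rewrite inE /h => /andP[/negbTE ->].
have := @optimal_cost_le q c S h; rewrite !(big_setID (A := S) A) /=.
rewrite (eq_bigr f hI) [X in (_ + X)%N](eq_bigr g hD).
have -> : \sum_(j in S :&: A) offer (c j) (h j) =
    \sum_(j in S :&: A) offer (c j) (f j).
  by apply: eq_bigr => j /hI ->.
have -> : \sum_(j in S :\: A) offer (c j) (h j) =
    \sum_(j in S :\: A) offer (c j) (g j).
  by apply: eq_bigr => j /hD ->.
by apply=> // j; rewrite /h; case: ifP.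
Qed.

(** Apply [exchange] to optimal plans for [lo] and [hi]; if either demand cannot be met, the right
    side is infinite. *)
Lemma optimal_cost_convex (lo hi a b : nat) c S :
  (forall j, j \in S -> convex_on_offers (n j) (offer (c j))) ->
  (a + b <= lo + hi)%N -> (a <= hi)%N -> (b <= hi)%N ->
  (optimal_cost (a%:R * m) p c S + optimal_cost (b%:R * m) p c S <=
   optimal_cost (lo%:R * m) p c S + optimal_cost (hi%:R * m) p c S)%E.
Proof.
move=> c_conv le_ab le_a le_b.
have [hiE|[v [le_vn le_v ->]]] := optimal_costP hi c S.
  rewrite hiE; have [->|[u [_ _ ->]]] := optimal_costP lo c S; exact: leey.
have [->|[u [le_un le_u ->]]] := optimal_costP lo c S; first exact: leey.
have [|||u' [v' [le_un' le_vn' le_u' le_v' le_cost]]] :=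
  @exchange R T n (fun j => offer (c j)) S u v a b c_conv le_un le_vn.
- by apply: leq_trans le_ab _; apply: leq_add.
- exact: leq_trans le_a _.
- exact: leq_trans le_b _.
apply: (@le_trans _ _ ((\sum_(j in S) offer (c j) (u' j))%:E +
                       (\sum_(j in S) offer (c j) (v' j))%:E)%E).
  by apply: leeD; apply: optimal_cost_le.
by rewrite -!EFinD lee_fin.
Qed.

(** For claim (i): [t] will be the optimal plan under the lowered bids [ct], and the bound then says
    that the payment to [j] is at most its cost under [c]. *)
Lemma optimal_cost_without_loser (q : nat) c ct (K : {set T}) (j : T) f t :
  j \in K ->
  (forall i, i \notin K -> convex_on_offers (n i) (offer (c i))) ->
  (forall i, i \notin K -> ct i = c i) ->
  (forall i, f i <= n i)%N -> (q <= \sum_(i in ~: K) f i)%N ->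
  optimal_cost (q%:R * m) p c [set: T] =
    (\sum_(i in ~: K) offer (c i) (f i))%:E ->
  (forall i, t i <= n i)%N -> (q <= \sum_(i in [set: T]) t i)%N ->
  (optimal_cost (q%:R * m) p ct ([set: T] :\ j) <=
   (\sum_(i in [set: T] :\ j) offer (ct i) (t i) + offer (c j) (t j))%:E)%E.
Proof.
move=> jK c_conv ctE le_fn le_qf fE le_tn.
rewrite (big_setD1 j) ?inE //= (big_setID K) /= setTD1I (setTD1D jK).
set r := (\sum_(i in K :\ j) t i)%N => le_qt.
(* Outside [K], [t] supplies at least [q - r - t j] and [f] at least [q]. The [t j] increments of
   slack are shifted, so that [u] makes up for the absence of [j] and [v] leaves room for its
   offer. *)
have [i||||u [v [le_un le_vn le_u le_v le_cost]]] :=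
  @exchange R T n (fun j => offer (c j)) (~: K) t f (q - r) (q - t j)
    _ le_tn le_fn; try lia.
  by rewrite inE => /c_conv.
pose tj i := if i == j then t j else 0%N.
have tj0 i : i \in K :\ j -> tj i = 0%N.
  by rewrite /tj !inE => /andP[/negbTE ->].
have le_tjn i : (tj i <= n i)%N by rewrite /tj; case: eqP => [->|].
(* [v] plus the offer of [j] competes with [f] in the auction under [c], so it costs at least as
   much as [f]. *)
have := @optimal_cost_glue q c [set: T] K tj v le_tjn le_vn.
rewrite setTI setTD fE !(big_setD1 j jK) /= big1 //.
rewrite [X in _ + X + _]big1 => [|i /tj0 ->]; last by rewrite offer0.
rewrite /tj eqxx addn0 addr0 lee_fin => le_vq.
(* [u] plus the offers of the rest of [K] clears the auction without [j]. *)
have := @optimal_cost_glue q ct ([set: T] :\ j) K t u le_tn le_un.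
rewrite setTD1I (setTD1D jK) => le_uq.
apply: le_trans (le_uq _) _; first by rewrite -/r; lia.
rewrite (big_setID (A := [set: T] :\ j) K) /= setTD1I (setTD1D jK) lee_fin.
have ctK h : \sum_(i in ~: K) offer (ct i) (h i) =
    \sum_(i in ~: K) offer (c i) (h i).
  by apply: eq_bigr => i; rewrite inE => /ctE ->.
rewrite !ctK; have /le_vq : (q <= t j + \sum_(i in ~: K) v i)%N by lia.
lra.
Qed.

Lemma sum_marginal_contributions (q : nat) c (C : {set T}) f :
  (forall i, i \notin C -> convex_on_offers (n i) (offer (c i))) ->
  (forall i, f i <= n i)%N -> (q <= \sum_(i in [set: T]) f i)%N ->
  optimal_cost (q%:R * m) p c [set: T] =
    (\sum_(i in [set: T]) offer (c i) (f i))%:E ->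
  (\sum_(j in C) (optimal_cost (q%:R * m) p c ([set: T] :\ j)
     - optimal_cost (q%:R * m) p c [set: T] + (offer (c j) (f j))%:E)
   <= optimal_cost (q%:R * m) p c (~: C)
      - (\sum_(i in ~: C) offer (c i) (f i))%:E)%E.
Proof.
move=> c_conv le_fn; rewrite !(big_setID (A := [set: T]) C) /= !setTI !setTD.
move=> le_q fE.
set X := \sum_(i in ~: C) _ in fE *; rewrite fE.
have [->|[g [le_gn le_g gE]]] := optimal_costP q c (~: C); first exact: leey.
(* What the outsiders cost once [C] supplies [b]. The truncated subtraction is itself convex in [b],
   so [G] stays convex beyond [q]. *)
pose G b := optimal_cost ((q - b)%:R * m) p c (~: C).
have GP b : exists h, [/\ forall j, (h j <= n j)%N,
    (q - b <= \sum_(j in ~: C) h j)%N &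
    G b = (\sum_(j in ~: C) offer (c j) (h j))%:E].
  have [GE|//] := optimal_costP (q - b) c (~: C).
  have := optimal_cost_le c le_gn (leq_trans (leq_subr b q) le_g).
  by rewrite GE leye_eq.
have GE b : G b = (fine (G b))%:E by have [h [_ _ ->]] := GP b.
set A := (\sum_(i in C) f i)%N in le_q.
(* A cheaper way for the outsiders to complement [C] would improve on the optimal plan [f]. *)
have XE : X = fine (G A).
  apply/eqP; rewrite eq_le -!lee_fin -GE; apply/andP; split; last first.
    by apply: optimal_cost_le => //; lia.
  have [h [le_hn le_h hE]] := GP A; rewrite hE lee_fin.
  have := @optimal_cost_glue q c [set: T] C f h le_fn le_hn.
  rewrite fE setTI setTD lee_fin lerD2l; apply; rewrite -/A; lia.
(* Without [j], the rest of [C] can keep its offers while the outsiders cover [f j] more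
   increments. *)
have step j : j \in C ->
    (optimal_cost (q%:R * m) p c ([set: T] :\ j)
     - (\sum_(i in C) offer (c i) (f i) + X)%:E + (offer (c j) (f j))%:E
     <= (fine (G (A - f j)%N) - fine (G A))%:E)%E.
  move=> jC; have [h [le_hn le_h hE]] := GP (A - f j)%N.
  have := @optimal_cost_glue q c ([set: T] :\ j) C f h le_fn le_hn.
  rewrite setTD1I (setTD1D jC).
  have AE : A = (f j + \sum_(i in C :\ j) f i)%N by rewrite /A (big_setD1 j).
  rewrite hE -XE /= (big_setD1 j jC) /=.
  have -> : (q <= \sum_(i in C :\ j) f i + \sum_(i in ~: C) h i)%N by lia.
  move=> /(_ isT); case: optimal_cost => [r||] //;
    last by move=> _; apply: leNye.
  by rewrite -!EFinD !lee_fin; lra.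
apply: le_trans (lee_sum _ step) _.
rewrite sumEFin gE -EFinB lee_fin XE.
have G0 : fine (G 0%N) = \sum_(j in ~: C) offer (c j) (g j).
  by rewrite /G subn0 gE.
have := @superadditive_sum _ (fun b => fine (G b)) _ _ (enum C) f 0.
rewrite /= add0n !big_enum /= -/A -G0; apply => x a b.
rewrite -lee_fin !EFinD -!GE; apply: optimal_cost_convex; try lia.
by move=> i; rewrite inE => /c_conv.
Qed.

End Clearing.

Theorem theorem4 (R : realType) (L : finType) (n : L -> nat) (M m : R)
    (p c : profile R n)
    (m_gt0 : 0 < m) (m_dvd_M : exists N : nat, M = N%:R * m)
    (p_spaced : forall j : L, equally_spaced m (p j))
    (c_imc : forall j : L, increasing_marginal_cost (p j) (c j)) :
  (* (i) *)
  (forall (cbar : profile R n) (K : {set L}) (x : allocation n),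
     (forall j, j \in K -> c j = cbar j) ->
     optimal M p c [set: L] x ->
     (forall j, j \in K -> losing x j) ->
   forall (ct : profile R n) (xt : allocation n),
     (forall j, j \in K -> forall k, ct j k ord0 <= cbar j k ord0) ->
     (forall j, j \notin K -> ct j = c j) ->
     optimal M p ct [set: L] xt ->
   forall j, j \in K ->
     (utility M p ct cbar [set: L] xt j <= utility M p c cbar [set: L] x j)%E)
  /\
  (* (ii): the members of C are identities of one participant, whose own offers
     and true costs are p0 and cbar0; k is the offer made of the power accepted
     from all these identities, and it is compared with truthful bidding as the
     single bidder None *)
  (forall (C : {set L}) (x : allocation n),
     optimal M p c [set: L] x ->
   forall (n0 : nat) (p0 cbar0 : 'cV[R]_n0) (k : 'I_n0.+1),
     equally_spaced m p0 ->
     with_zero p0 k = \sum_(j in C) accepted (p j) (x j) ->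
   forall x1 : allocation (single_size n n0),
     optimal M (single_profile p p0) (single_profile c cbar0)
       (single_bidders C) x1 ->
     (\sum_(j in C) vcg_payment M p c [set: L] x j - (with_zero cbar0 k)%:E
      <= utility M (single_profile p p0) (single_profile c cbar0)
           (single_profile c cbar0) (single_bidders C) x1 None)%E).
Proof.
case: m_dvd_M => q ->.
have c_conv j : convex_on_offers (n j) (offer (c j)).
  exact: increasing_marginal_cost_convex m_gt0 (@p_spaced j) (@c_imc j).
split=> [cbar K x cE x_opt x_lose ct xt _ ctE xt_opt j jK|].
  have [f [le_fn le_f xE fE]] := optimalP m_gt0 p_spaced x_opt.
  have [t [le_tn le_t xtE tE]] := optimalP m_gt0 p_spaced xt_opt.
  have f0 i : i \in K -> f i = 0%N.
    move=> iK; case fi: (f i) (le_fn i) => [//|k] lt_kn.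
    have := x_lose i iK (Ordinal lt_kn).
    by rewrite xE ?inE // ffunE fi eqxx.
  have f_notK : (\sum_(i in ~: K) f i = \sum_(i in [set: L]) f i)%N.
    by rewrite [RHS](big_setID K) /= setTI setTD [X in (X + _)%N]big1.
  have c_notK : \sum_(i in ~: K) offer (c i) (f i) =
      \sum_(i in [set: L]) offer (c i) (f i).
    rewrite [RHS](big_setID K) /= setTI setTD.
    by rewrite [X in X + _]big1 ?add0r // => i /f0 ->; apply: offer0.
  have acc0 v : accepted (v j) (x j) = 0 :> R.
    by rewrite xE ?inE // f0 // accepted_single_offer ?offer0.
  (* Zero separates the profits: a truthful loser earns the nonnegative rise in cost caused by its
     removal, while lowering yields at most 0. *)
  apply: (@le_trans _ _ 0%E); last first.
    rewrite /utility /vcg_payment !acc0 sube0 adde0 fE.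
    have [->|[g [le_gn le_g gE]]] :=
      optimal_costP m_gt0 p_spaced q c ([set: L] :\ j); first exact: leey.
    have := optimal_cost_glue m_gt0 p_spaced (q := q) (S := [set: L]) c
      (A := [set j]) (f := fun=> 0%N) _ le_gn.
    rewrite setTI !big_set1 offer0 add0r fE gE lee_fin => /(_ (fun=> leq0n _)).
    rewrite -EFinB lee_fin subr_ge0; exact.
  have := optimal_cost_without_loser m_gt0 p_spaced jK
    (fun i _ => c_conv i) ctE le_fn _ _ le_tn le_t.
  rewrite f_notK c_notK => /(_ le_f fE).
  rewrite /utility /vcg_payment tE xtE ?inE // !accepted_single_offer //.
  rewrite (big_setD1 (A := [set: L]) j) ?inE //= cE //.
  case: optimal_cost => [r||] //;
    last by move=> _; apply: leNye.
  by rewrite -!EFinD !lee_fin; lra.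
move=> C x x_opt n0 p0 cbar0 k p0_spaced kE x1 x1_opt.
have [f [le_fn le_f xE fE]] := optimalP m_gt0 p_spaced x_opt.
have s_spaced o : equally_spaced m (single_profile p p0 o) by case: o.
have [g [le_gn le_g x1E gE]] := optimalP m_gt0 s_spaced x1_opt.
(* The single bidder is truthful, so its accepted cost cancels and its marginal contribution
   remains. *)
rewrite /utility /vcg_payment addeK // gE.
have kC : k = (\sum_(j in C) f j)%N :> nat.
  apply/eqP; rewrite -(eqr_nat R) -(inj_eq (mulIf (lt0r_neq0 m_gt0))).
  rewrite -p0_spaced kE (total_power p_spaced le_fn) // => j _.
  by rewrite xE ?inE.
(* Generic in the operation, to split both counts of increments and costs. *)
have sumS (V : Type) (idx : V) (op : Monoid.com_law idx) (F : option L -> V) :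
    \big[op/idx]_(o in single_bidders C) F o =
    op (F None) (\big[op/idx]_(j in ~: C) F (Some j)).
  rewrite big_setU1 ?big_imset //=; first by move=> i j _ _ [].
  by apply/imsetP => -[].
have S_None : single_bidders C :\ None = [set Some j | j in ~: C].
  rewrite setU1K //; by apply/imsetP => -[].
(* The multi-identity outcome replayed with one bidder: it bounds the optimal cost of the
   single-identity auction. *)
pose h o := if o is Some j then f j else k : nat.
have le_hn o : (h o <= single_size n n0 o)%N.
  by case: o => [j|] /=; rewrite ?le_fn // -ltnS.
have le_single := optimal_cost_le m_gt0 s_spaced
  (single_profile c cbar0) le_hn (q := q) (S := single_bidders C).
move: le_single; rewrite gE !sumS /= {1}kC.
have -> : offer cbar0 k = with_zero cbar0 k by rewrite /offer inord_val.
have -> : (q <= \sum_(j in C) f j + \sum_(j in ~: C) f j)%N.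
  by move: le_f; rewrite (big_setID C) setTI setTD.
rewrite lee_fin => /(_ isT) le_single.
have := sum_marginal_contributions m_gt0 p_spaced (C := C)
  (fun j _ => c_conv j) le_fn le_f fE.
under [X in (X <= _)%E -> _]eq_bigr => j _.
  rewrite -(accepted_single_offer (c j) (le_fn j)) -xE ?inE //.
  over.
rewrite S_None => le_sum.
have [->|[h' [le_hn' le_h' hE']]] := optimal_costP m_gt0 s_spaced q
  (single_profile c cbar0) [set Some j | j in ~: C]; first exact: leey.
have := optimal_cost_le m_gt0 p_spaced c (fun j => le_hn' (Some j))
  (q := q) (S := ~: C).
rewrite hE'; move: le_h'; rewrite !big_imset //=; try by move=> i j _ _ [].
move=> le_h' /(_ le_h') le_C.
apply: le_trans (leeD2r _ le_sum) _.
move: le_C; case: (optimal_cost _ p c (~: C)) => [r||] //.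
  by rewrite -EFinN -!EFinD !lee_fin; lra.
by move=> _; apply: leNye.
Qed.
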